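(* Let $n,d\ge0$, and let $B_{m,k}$, $B_n$, $C_{n,d}$, $O_{n,d}$, $T_{n,d}$, $A_{n,d}$, $\omega$, $\tau$, $\beta$, $\phi$ be as defined in the context. (i) The maps $o:O_{n,d}\to B_{n-d,d}$ and $t:T_{n,d}\to B_{n-d,d}$ defined by $$o(\omega_0,\omega_1,\ldots,\omega_d)=1^{\omega_d-1}\,2\,1^{\omega_{d-1}-1}\,2\cdots1^{\omega_1-1}\,2\,1^{\omega_0}$$ and $$t(\tau_0,\tau_1,\ldots,\tau_d)=1^{\tau_d}\,2\,1^{\tau_{d-1}-1}\,2\,1^{\tau_{d-2}-1}\cdots2\,1^{\tau_0-1}$$ are bijections. Thus $|O_{n,d}|=|T_{n,d}|=C_{n,d}$. (ii) The map $\omega\times\tau:A_{n,d}\to O_{n,d}\times T_{n,d}$ given by $v\mapsto(\omega(v),\tau(v))$ is a bijection. Thus $|A_{n,d}|=C_{n,d}^2$. (iii) Composing maps from right to left, and regarding the maps above (taken for all $d\ge0$) as maps on the disjoint unions over $d$, we have $$\beta=(o\times t)\circ(\omega\times\tau)\circ\phi^{-1}$$ as maps $B_n\to\biguplus_{d\ge0}B_{n-d,d}\times B_{n-d,d}$.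
   Context: $\mathbb N$ and $\mathbb P$ are the nonnegative and positive integers, and $\mathbb P^*$ is the set of all finite words in $\mathbb P$. $a^m$ denotes $m$ copies of the letter $a$; $\Pi(w)$ is the set of all rearrangements of the word $w$. A word in $\{1,2\}^*$ is a ballot sequence if every prefix contains at least as many ones as twos. $B_{m,k}$ is the set of ballot sequences in $\Pi(1^m2^k)$ (empty if $m<0$), $B_n=B_{n,n}$, and $C_{n,d}=|B_{n-d,d}|$ (which is $0$ for $d>\lfloor n/2\rfloor$). Foata's fundamental bijection $\phi:\mathbb P^*\to\mathbb P^*$: $\phi(\epsilon)=\epsilon$ for the empty word $\epsilon$. For $v=a_1\ldots a_n$ with $n\ge1$, define $w_1=a_1$ and, given $w_i=b_1\ldots b_i$, define $w_{i+1}$ as follows. If $b_i\le a_{i+1}$ (respectively $b_i>a_{i+1}$), factor $w_i=f_1f_2\cdots f_k$ uniquely so that in each factor every letter is $>a_{i+1}$ (respectively $\le a_{i+1}$) except its last letter, which is $\le a_{i+1}$ (respectively $>a_{i+1}$). Let $g_j$ be obtained from $f_j$ by moving its last letter to the front, and set $w_{i+1}=g_1g_2\cdots g_k\,a_{i+1}$. Then $\phi(v)=w_n$. The map $\phi$ is a bijection preserving the multiset of letters. Every $v\in\{1,2\}^*$ with exactly $d$ descents (indices $i$ at which the $i$th letter exceeds the next one) is uniquely $v=1^{m_0}2^{n_0}1^{m_1}2^{n_1}\cdots1^{m_d}2^{n_d}$ with $m_0,n_d\ge0$ and all other $m_i,n_j>0$. Set $\omega(v)=(m_0,m_1,\ldots,m_d)\in\mathbb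 N\times\mathbb P^d$ and $\tau(v)=(n_0,n_1,\ldots,n_d)\in\mathbb P^d\times\mathbb N$. $A_{n,d}$ is the set of $v\in\{1,2\}^*$ with exactly $d$ descents such that $\phi(v)\in B_n$, so $\phi^{-1}(B_n)=\biguplus_{d\ge0}A_{n,d}$. $O_{n,d}$ is the set of $(\omega_0,\ldots,\omega_d)\in\mathbb N\times\mathbb P^d$ with $\omega_0+\cdots+\omega_d=n$ and $\omega_d+\omega_{d-1}+\cdots+\omega_{d-i+1}\ge2i$ for $1\le i\le d$. $T_{n,d}$ is the set of $(\tau_0,\ldots,\tau_d)\in\mathbb P^d\times\mathbb N$ with $\tau_0+\cdots+\tau_d=n$ and $\tau_d+\tau_{d-1}+\cdots+\tau_{d-i+1}\ge2i-1$ for $1\le i\le d$. When $d=0$ the formulas for $o$ and $t$ read $o(\omega_0)=1^{\omega_0}$ and $t(\tau_0)=1^{\tau_0}$. For $w=b_1\ldots b_k\in\{1,2\}^*$ let $w'=b_k'\ldots b_2'b_1'$ with $b_i'=3-b_i$. The map $\beta:B_n\to\biguplus_{d\ge0}B_{n-d,d}\times B_{n-d,d}$ is defined by $\beta(w)=(x,y')$, where $w=xy$ with $x$ and $y$ both of length $n$. *)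

(* Defs.v *)
From mathcomp Require Import all_boot all_order all_algebra finmap.
From mathcomp Require Import boolp classical_sets functions cardinality.

Set Implicit Arguments.
Unset Strict Implicit.
Unset Printing Implicit Defensive.

Local Open Scope classical_set_scope.

(* Words are lists of naturals; the alphabet is the set of positive integers. *)
Definition words : set (seq nat) := [set w | all (fun a => 0 < a) w].

Definition words12 : set (seq nat) := [set w | all [in [:: 1; 2]] w].

Definition rearrangements (w : seq nat) : set (seq nat) := [set u | perm_eq u w].

Definition ballot (w : seq nat) : Prop :=
  words12 w /\ forall u, prefix u w -> count_mem 2 u <= count_mem 1 u.

(* The exponent of the letter 1 is an integer, so that Bset (n - d) d is empty
   for n < d. *)
Definition Bset (m : int) (k : nat) : set (seq nat) :=
  if m is Posz m' then
    [set w | rearrangements (nseq m' 1 ++ nseq k 2) w /\ ballot w]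
  else set0.

Definition Bdiag (n : nat) : set (seq nat) := Bset n%:Z%R n.

Definition Cnum (n d : nat) : nat := #|` fset_set (Bset (n%:Z - d%:Z)%R d)|%fset.

(* [factors p w] cuts w after each letter satisfying p.  In [phi_step] the last
   letter of w satisfies p, so every factor ends with such a letter. *)
Fixpoint factors (p : pred nat) (w : seq nat) : seq (seq nat) :=
  if w is b :: w' then
    if p b then [:: b] :: factors p w'
    else if factors p w' is f :: fs then (b :: f) :: fs else [:: [:: b]]
  else [::].

(* On the empty word the result is [:: a], whatever the value of [last]. *)
Definition phi_step (w : seq nat) (a : nat) : seq nat :=
  let p := if last 0 w <= a then (fun c => c <= a) else (fun c => a < c) in
  rcons (flatten [seq rotr 1 f | f <- factors p w]) a.

Definition phi (v : seq nat) : seq nat := foldl phi_step [::] v.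

Definition phi_inv : seq nat -> seq nat := 'pinv_(fun=> [::]) words phi.

Definition des (v : seq nat) : nat :=
  count (fun i => nth 0 v i.+1 < nth 0 v i) (iota 0 (size v).-1).

(* [blocks v] is the list (m_0, n_0), ..., (m_d, n_d) of exponents in
   v = 1^m_0 2^n_0 ... 1^m_d 2^n_d; see [blocksP]. *)
Fixpoint blocks (v : seq nat) : seq (nat * nat) :=
  if v is a :: v' then
    if blocks v' is (m, n) :: r then
      if a == 1 then (m.+1, n) :: r
      else if m == 0 then (0, n.+1) :: r
      else [:: (0, 1), (m, n) & r]
    else [::]
  else [:: (0, 0)].

Definition omega (v : seq nat) : seq nat := unzip1 (blocks v).
Definition tau (v : seq nat) : seq nat := unzip2 (blocks v).

Lemma blocks_neq0 v : blocks v != [::].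
Proof.
elim: v => //= a v; case: (blocks v) => // -[m n] r _.
by case: ifP => // _; case: ifP.
Qed.

Lemma blocks_head v : ((head (0, 0) (blocks v)).1 == 0) = (head 0 v != 1).
Proof.
case: v => //= a v; have := blocks_neq0 v.
by case: (blocks v) => // -[m n] r _; case: ifP => // _; case: ifP.
Qed.

Lemma des_cons a v : des (a :: v) = (head a v < a) + des v.
Proof.
case: v => [|b v]; first by rewrite /des /= ltnn.
rewrite /des /=; congr (_ + _).
by rewrite (iotaDl 1 0) count_map.
Qed.

Lemma blocksP v : words12 v ->
  [/\ v = flatten [seq nseq mn.1 1 ++ nseq mn.2 2 | mn <- blocks v],
      size (blocks v) = (des v).+1,
      forall i, 0 < i <= des v -> 0 < nth 0 (omega v) i &
      forall j, j < des v -> 0 < nth 0 (tau v) j].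
Proof.
rewrite /words12 /omega /tau /=; elim: v => [_|a v IH /= /andP[a12 v12]].
  by split=> // -[|i].
have {IH v12} [Ev Es Em En] := IH v12; have := blocks_head v.
move: Ev Es Em En (blocks_neq0 v); rewrite des_cons.
case: (blocks v) => // -[m n] r /= Ev [Es] Em En _ hd.
move: a12; rewrite !inE => /orP[] /eqP-> /=.
  have -> : (head 1 v < 1) = false.
    case: (v) (Ev) => //= b w Eb; apply/negbTE; rewrite -leqNgt.
    have : b \in b :: w by rewrite mem_head.
    rewrite Eb mem_cat => /orP[|/flattenP[s /mapP[[k l] _ ->]]].
      by rewrite mem_cat !mem_nseq => /orP[] /andP[_ /eqP->].
    by rewrite mem_cat !mem_nseq => /orP[] /andP[_ /eqP->].
  by rewrite add0n Es {1}Ev; split=> //; case=> [|i] // /Em.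
have hv : (head 2 v < 2) = (head 0 v == 1).
  case: (v) (Ev) => //= b w Eb.
  have : b \in b :: w by rewrite mem_head.
  rewrite Eb mem_cat => /orP[|/flattenP[s /mapP[[k l] _ ->]]].
    by rewrite mem_cat !mem_nseq => /orP[] /andP[_ /eqP->].
  by rewrite mem_cat !mem_nseq => /orP[] /andP[_ /eqP->].
rewrite hv; case: (head 0 v == 1) hd; case: m Ev Em => [|m] //= Ev Em _.
  rewrite Es {1}Ev add1n; split=> //; first by case=> [|[|i]] //= /(Em i.+1).
  by case=> [|j] //; rewrite ltnS => /En.
by rewrite add0n Es {1}Ev; split=> //; case=> [|j] // /En.
Qed.

Definition Aset (n d : nat) : set (seq nat) :=
  [set v | [/\ words12 v, des v = d & Bdiag n (phi v)]].

(* Elements of N x P^d and P^d x N are lists of size d.+1. *)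
Definition Oset (n d : nat) : set (seq nat) :=
  [set s | [/\ size s = d.+1,
               forall i, 1 <= i <= d -> 0 < nth 0 s i,
               \sum_(0 <= j < d.+1) nth 0 s j = n &
               forall i, 1 <= i <= d ->
                 2 * i <= \sum_(d - i + 1 <= j < d.+1) nth 0 s j]].

Definition Tset (n d : nat) : set (seq nat) :=
  [set s | [/\ size s = d.+1,
               forall i, i < d -> 0 < nth 0 s i,
               \sum_(0 <= j < d.+1) nth 0 s j = n &
               forall i, 1 <= i <= d ->
                 2 * i - 1 <= \sum_(d - i + 1 <= j < d.+1) nth 0 s j]].

Definition o_map (s : seq nat) : seq nat :=
  flatten [seq rcons (nseq x.-1 1) 2 | x <- rev (behead s)] ++ nseq (head 0 s) 1.

Definition t_map (s : seq nat) : seq nat :=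
  nseq (last 0 s) 1 ++
  flatten [seq 2 :: nseq x.-1 1 | x <- behead (rev s)].

Definition prime_word (w : seq nat) : seq nat := rev [seq 3 - b | b <- w].

Definition beta (n : nat) (w : seq nat) : seq nat * seq nat :=
  (take n w, prime_word (drop n w)).

Definition omega_tau (v : seq nat) : seq nat * seq nat := (omega v, tau v).

Definition o_t (p : seq nat * seq nat) : seq nat * seq nat := (o_map p.1, t_map p.2).

(* Main.v *)
Require Import Defs.
From mathcomp Require Import all_boot all_order all_algebra finmap zify.
From mathcomp Require Import boolp classical_sets functions cardinality.

(** Everything rests on one closed formula, [phiE]: for a binary word [v],
      phi v = o (omega v) ++ (t (tau v))'.
    On binary words a step of Foata's map is very simple.  Appending 2 leaves
    the current word alone; appending 1 first moves the last letter to the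
    front, because the letters that end the factors are then all equal to that
    last letter, so moving each of them to the front of its factor shifts the
    whole word cyclically by one place.  Hence each letter of [v] that is
    followed by 1 is thrown to the front of phi v, while the others stay at the
    back in order.  Reading v = 1^m_0 2^n_0 ... 1^m_d 2^n_d in this way, the
    letters thrown to the front depend on the exponents m_i and the others on
    the exponents n_j, apart from one 1 where the two parts meet.  This is the
    formula; its first half, o (omega v), has as many letters as [v] has ones.

    If phi v is in B_n the cut between the two halves is therefore in the middle
    of phi v, so beta (phi v) = (o (omega v), t (tau v)) ([betaE]).  Cutting a
    balanced word xy' in the middle turns the ballot condition into the ballot
    condition for x and for y separately ([above_cat_prime], [Bdiag_cat]): a
    prefix of xy' that reaches into y' leaves out the reverse of a prefix of y,
    with the letters exchanged.

    It remains to know that o and t are bijections.  A binary word with d twos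
    is the same thing as the list of the d+1 lengths of the runs of ones between
    the twos ([gap_word], [gaps]), and the ballot condition says that the first
    i lengths add up to at least i ([above_gaps]).  The conditions that define
    O_{n,d} and T_{n,d} are this one after subtracting 1 from every entry other
    than omega_0, respectively other than tau_d ([OsetP], [TsetP]).

    Finally [v] is recovered from its exponents, and any admissible exponents
    occur ([unblocksK]).  So omega x tau is a bijection from A_{n,d} onto
    O_{n,d} x T_{n,d}; with the formula this also shows that every word of B_n
    has a binary preimage under phi.  As phi preserves the multiset of letters,
    the preimage chosen by [phi_inv] among all words is binary too. *)

Local Open Scope classical_set_scope.
Local Open Scope card_scope.

(** * Binary words and the involution w -> w' *)

Lemma words12_cat u v : words12 (u ++ v) <-> words12 u /\ words12 v.
Proof. by rewrite /words12 /= all_cat; split=> /andP. Qed.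

Lemma words12_rcons u a :
  words12 (rcons u a) <-> words12 u /\ (a == 1) || (a == 2).
Proof.
rewrite -cats1 words12_cat /words12 /= andbT !inE.
by split.
Qed.

Lemma words12_cons a u :
  words12 (a :: u) <-> (a == 1) || (a == 2) /\ words12 u.
Proof. by rewrite /words12 /= !inE; split=> /andP. Qed.

Lemma words12_ind (P : seq nat -> Prop) :
  P [::] -> (forall v, words12 v -> P v -> P (1 :: v)) ->
  (forall v, words12 v -> P v -> P (2 :: v)) ->
  forall v, words12 v -> P v.
Proof.
move=> P0 P1 P2; elim=> // a v IH /words12_cons[/orP[]/eqP-> v12].
  by apply: P1 => //; apply: IH.
by apply: P2 => //; apply: IH.
Qed.

Lemma size_words12 w : words12 w -> size w = count_mem 1 w + count_mem 2 w.
Proof. by elim/words12_ind => //= v _ ->; rewrite ?addnS. Qed.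

Lemma perm_words12 w : words12 w ->
  perm_eq w (nseq (count_mem 1 w) 1 ++ nseq (count_mem 2 w) 2).
Proof.
elim/words12_ind => // v _ IH; first by rewrite /= perm_cons.
rewrite [count_mem 1 _]/= [count_mem 2 _]/= add0n add1n perm_sym.
by rewrite -[nseq _.+1 _]cat1s perm_catCA perm_cons perm_sym.
Qed.

Lemma prime_cat u v : prime_word (u ++ v) = prime_word v ++ prime_word u.
Proof. by rewrite /prime_word map_cat rev_cat. Qed.

Lemma prime_cons a v : prime_word (a :: v) = rcons (prime_word v) (3 - a).
Proof. by rewrite /prime_word /= rev_cons. Qed.

Lemma prime_rcons v a : prime_word (rcons v a) = 3 - a :: prime_word v.
Proof. by rewrite /prime_word map_rcons rev_rcons. Qed.

Lemma prime_word12 w : words12 w -> words12 (prime_word w).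
Proof. by elim/words12_ind => //= v _ IH; rewrite prime_cons words12_rcons. Qed.

Lemma prime_wordK w : words12 w -> prime_word (prime_word w) = w.
Proof.
by elim/words12_ind => //= v _ IH; rewrite prime_cons prime_rcons IH.
Qed.

Lemma count1_prime w : words12 w -> count_mem 1 (prime_word w) = count_mem 2 w.
Proof.
elim/words12_ind => //= v _ IH;
  by rewrite prime_cons -cats1 count_cat IH /= ?addn0 ?addn1.
Qed.

Lemma count2_prime w : words12 w -> count_mem 2 (prime_word w) = count_mem 1 w.
Proof.
elim/words12_ind => //= v _ IH;
  by rewrite prime_cons -cats1 count_cat IH /= ?addn0 ?addn1.
Qed.

Lemma size_prime w : size (prime_word w) = size w.
Proof. by rewrite size_rev size_map. Qed.

(** * One step of Foata's map on binary words *)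

(** When a letter b is put in front of the first factor f, [rotr 1 (b :: f)] is
    [rotr 1 f] with b inserted after its first letter; this is where f must not
    be empty. *)
Lemma factors_neq0 p w : [::] \notin factors p w.
Proof.
elim: w => //= b w; case: (p b) => //=.
by case: (factors p w) => //= f fs; rewrite !inE !negb_or => /andP[_ ->].
Qed.

(** All factors end with the same letter [c], so the [c] moved to the front of a
    factor replaces the one that has left the end of the previous factor: the
    net effect is to move the last letter of the word to the front. *)
Lemma flatten_rotr_factors (p : pred nat) c u :
  p c -> (forall b, b \in u -> p b -> b = c) ->
  flatten [seq rotr 1 f | f <- factors p (rcons u c)] = c :: u.
Proof.
move=> pc; elim: u => [|b u IH] /= uc; first by rewrite pc.
have {}IH := IH (fun x xu => uc x (mem_behead (s := b :: u) xu)).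
case: ifP => [pb | _]; first by rewrite /= IH (uc b (mem_head _ _) pb).
have := factors_neq0 p (rcons u c).
case: (factors p (rcons u c)) IH => [|f fs] //=.
case/lastP: f => [|f x] //.
by rewrite -rcons_cons !rotr1_rcons /= => -[-> ->].
Qed.

(** Whatever the last letter of [w] is, the factors are cut after the letters
    equal to it. *)
Lemma phi_step1 w : words12 w -> phi_step w 1 = rcons (rotr 1 w) 1.
Proof.
case/lastP: w => [|u c] //; rewrite words12_rcons => -[u12 c12].
rewrite /phi_step last_rcons rotr1_rcons flatten_rotr_factors //.
  by case: ifP; lia.
move=> b /(allP u12); rewrite !inE.
by case/orP: c12 => /eqP-> /orP[] /eqP->.
Qed.

(** No binary letter exceeds 2, so all factors are single letters. *)
Lemma phi_step2 w : words12 w -> phi_step w 2 = rcons w 2.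
Proof.
move=> w12; rewrite /phi_step; congr rcons.
have -> : last 0 w <= 2.
  case/lastP: w w12 => [|u c] //; rewrite words12_rcons last_rcons.
  by case=> _ /orP[] /eqP->.
by elim/words12_ind: w12 => //= v _ /= ->.
Qed.

Lemma perm_phi v : perm_eq (phi v) v.
Proof.
have step w a : perm_eq (phi_step w a) (a :: w).
  rewrite /phi_step; move: (if _ then _ else _) => p.
  rewrite perm_rcons perm_cons.
  apply: (@perm_trans _ (flatten (factors p w))).
    elim: (factors p w) => //= f fs; apply: perm_cat.
    by rewrite perm_rotr.
  elim: w => //= b w; case: (p b) => /=; first by rewrite perm_cons.
  by case: (factors p w) => [|f fs] /=; rewrite perm_cons.
elim/last_ind: v => // v a IH.
rewrite /phi foldl_rcons (perm_trans (step _ _)) //.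
by rewrite perm_sym perm_rcons perm_cons perm_sym.
Qed.

(** * The closed formula for phi v *)

Lemma blocks_cons1 v m n r :
  blocks v = (m, n) :: r -> blocks (1 :: v) = (m.+1, n) :: r.
Proof. by move=> /= ->. Qed.

Lemma blocks_cons2 v : exists n r,
  blocks (2 :: v) = (0, n.+1) :: r.
Proof.
rewrite /=; case: (blocks v) (blocks_neq0 v) => // -[[|m] n] r _ /=.
  by exists n, r.
by exists 0, ((m.+1, n) :: r).
Qed.

(** The six recurrences below follow the first one or two letters of [v]; they
    are matched against the recurrences of the two halves of phi v in
    [foldl_phi_step]. *)
Lemma o_map_omega1 v : o_map (omega (1 :: v)) = rcons (o_map (omega v)) 1.
Proof.
have := blocks_neq0 v; rewrite /omega.
case E: (blocks v) => [|[m n] r] // _.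
rewrite (blocks_cons1 _ _ _ _ E) /o_map /= -!cats1 -catA; congr cat.
by rewrite -(nseqD _ 1) addn1.
Qed.

Lemma o_map_omega21 v :
  o_map (omega [:: 2, 1 & v]) = rcons (o_map (omega v)) 2.
Proof.
have := blocks_neq0 v; rewrite /omega.
case E: (blocks v) => [|[m n] r] // _ /=.
rewrite E /o_map /= cats0 rev_cons map_rcons -cats1 flatten_cat /=.
by rewrite cats0 -!cats1 catA.
Qed.

Lemma o_map_omega22 v : o_map (omega [:: 2, 2 & v]) = o_map (omega (2 :: v)).
Proof.
have [n [r E]] := blocks_cons2 v.
rewrite /omega E.
have -> : blocks [:: 2, 2 & v] = (0, n.+2) :: r by move: E => /= ->.
by [].
Qed.

Lemma t_map_cons x s : s != [::] ->
  t_map (x :: s) = t_map s ++ 2 :: nseq x.-1 1.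
Proof.
case/lastP: s => // s y _.
rewrite /t_map -rcons_cons !rev_rcons !last_rcons /= rev_cons map_rcons.
by rewrite -cats1 flatten_cat /= cats0 catA.
Qed.

Lemma t_map_incr x s : t_map (x.+2 :: s) = rcons (t_map (x.+1 :: s)) 1.
Proof.
case: s => [|y s].
  by rewrite /t_map /= !cats0 -[_ :: _ :: _]/(nseq x.+2 1) -addn1 nseqD cats1.
rewrite (t_map_cons x.+2) // (t_map_cons x.+1) // -cats1 -catA cat_cons.
congr (_ ++ 2 :: _).
by rewrite /= -(nseqD x 1) addn1.
Qed.

Definition t_prime v := prime_word (t_map (tau v)).

Lemma t_prime1 v : t_prime (1 :: v) = t_prime v.
Proof.
have := blocks_neq0 v; rewrite /t_prime /tau.
by case E: (blocks v) => [|[m n] r] // _; rewrite (blocks_cons1 _ _ _ _ E).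
Qed.

Lemma t_prime21 v : t_prime [:: 2, 1 & v] = 1 :: t_prime v.
Proof.
have := blocks_neq0 v; rewrite /t_prime /tau.
case E: (blocks v) => [|[m n] r] // _ /=; rewrite E /= t_map_cons //=.
by rewrite prime_cat.
Qed.

Lemma t_prime22 v : t_prime [:: 2, 2 & v] = 2 :: t_prime (2 :: v).
Proof.
have [n [r E]] := blocks_cons2 v; rewrite /t_prime /tau E.
have -> : blocks [:: 2, 2 & v] = (0, n.+2) :: r by move: E => /= ->.
by rewrite /= t_map_incr prime_rcons.
Qed.

(** A word already built, [u] with last letter 1 or 2, ends up as a block in the
    middle: what is thrown in front of it and what follows it depend only on its
    last letter and the remaining input [w].  That last letter itself goes to
    the front or stays, according to the next letter, which is why it counts as
    part of the input [2 :: w] in the second equation.  In the first equation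
    it can be left out of the input, because some 1 stands right behind [u] in
    either case: if the last letter goes to the front, the next letter is 1 and
    takes its place. *)
Lemma foldl_phi_step w : words12 w -> forall u, words12 u ->
  foldl phi_step (rcons u 1) w = o_map (omega w) ++ u ++ 1 :: t_prime w /\
  foldl phi_step (rcons u 2) w =
    o_map (omega (2 :: w)) ++ u ++ t_prime (2 :: w).
Proof.
have stepE u c : words12 (rcons u c) ->
    phi_step (rcons u c) 1 = rcons (c :: u) 1 /\
    phi_step (rcons u c) 2 = rcons (rcons u c) 2.
  by move=> uc12; rewrite phi_step1 // rotr1_rcons phi_step2.
elim/words12_ind => [u u12 | v v12 IH u u12 | v v12 IH u u12].
- by rewrite /= -!cats1.
- have u1 : words12 (1 :: u) by [].
  have u2 : words12 (2 :: u) by [].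
  have r1 : words12 (rcons u 1) by apply/words12_rcons.
  have r2 : words12 (rcons u 2) by apply/words12_rcons.
  rewrite /= (stepE _ _ r1).1 (stepE _ _ r2).1 (IH _ u1).1 (IH _ u2).1.
  rewrite o_map_omega1 t_prime1 o_map_omega21 t_prime21.
  by rewrite !cat_rcons.
- have r1 : words12 (rcons u 1) by apply/words12_rcons.
  have r2 : words12 (rcons u 2) by apply/words12_rcons.
  rewrite [foldl _ _ (2 :: v)]/= (stepE _ _ r1).2 (IH _ r1).2.
  rewrite [foldl _ _ (2 :: v)]/= (stepE _ _ r2).2 (IH _ r2).2.
  by rewrite o_map_omega22 t_prime22 !cat_rcons.
Qed.

(** Start the previous lemma from a one-letter word.  If the first letter is 1,
    it is the last letter of o (omega v). *)
Lemma phiE v : words12 v ->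
  phi v = o_map (omega v) ++ prime_word (t_map (tau v)).
Proof.
case: v => [|a v] // /words12_cons[a12 v12]; rewrite -/(t_prime (a :: v)).
have -> : phi (a :: v) = foldl phi_step (rcons [::] a) v by [].
have [E1 E2] := foldl_phi_step v v12 [::] isT.
case/orP: a12 => /eqP->; last by rewrite E2.
by rewrite E1 o_map_omega1 t_prime1 cat_rcons.
Qed.

(** This locates the cut between the two halves of phi v. *)
Lemma size_o_map_omega w : words12 w -> size (o_map (omega w)) = count_mem 1 w.
Proof.
elim/words12_ind => // [v _ IH | v v12 IH].
  by rewrite o_map_omega1 size_rcons IH.
case: v v12 IH => [|a v] // /words12_cons[/orP[]/eqP-> _ IH].
  by move: IH; rewrite o_map_omega1 o_map_omega21 !size_rcons.
by rewrite o_map_omega22.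
Qed.

(** * Recovering a binary word from its exponents *)

Lemma blocks_ones m w m0 n r : blocks w = (m0, n) :: r ->
  blocks (nseq m 1 ++ w) = (m + m0, n) :: r.
Proof. by move=> E; elim: m => //= m ->. Qed.

Lemma blocks_twos n w m k r : blocks w = (m.+1, k) :: r ->
  blocks (nseq n.+1 2 ++ w) = [:: (0, n.+1), (m.+1, k) & r].
Proof. by move=> E; elim: n => [|n /= ->] //=; rewrite E. Qed.

Definition unblocks (s : seq (nat * nat)) : seq nat :=
  flatten [seq nseq mn.1 1 ++ nseq mn.2 2 | mn <- s].

Lemma unblocks12 s : words12 (unblocks s).
Proof.
elim: s => // x s IH; apply/words12_cat; split=> //.
by apply/words12_cat; rewrite /words12 /= !all_nseq /= !orbT.
Qed.

(** The hypotheses say that m_1, ..., m_d and n_0, ..., n_(d-1) are positive, so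
    that no two neighbouring runs merge. *)
Lemma unblocksK s : s != [::] ->
  all (fun x => 0 < x) (behead (unzip1 s)) ->
  all (fun x => 0 < x) (behead (rev (unzip2 s))) ->
  blocks (unblocks s) = s.
Proof.
elim: s => // -[m n] [_ _ _ _ | [m1 n1] s IH _].
  have -> : unblocks [:: (m, n)] = nseq m 1 ++ nseq n 2.
    by rewrite /unblocks /= cats0.
  have /blocks_ones-> : blocks (nseq n 2) = [:: (0, n)] by elim: n => //= n ->.
  by rewrite addn0.
rewrite [behead _]/= => /andP[m1_gt0 s1].
have -> : behead (rev (unzip2 ((m, n) :: (m1, n1) :: s))) =
    rcons (behead (rev (unzip2 ((m1, n1) :: s)))) n.
  by rewrite /= rev_cons; case: (rev _) (size_rev (n1 :: unzip2 s)).
rewrite all_rcons => /andP[n_gt0 s2].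
have E := IH isT s1 s2.
have -> : unblocks ((m, n) :: (m1, n1) :: s) =
    nseq m 1 ++ (nseq n 2 ++ unblocks ((m1, n1) :: s)).
  by rewrite /unblocks /= -!catA.
case: m1 m1_gt0 E {IH s1 s2} => // m1 _ E; case: n n_gt0 => // n _.
by rewrite (blocks_ones _ _ _ _ _ (blocks_twos _ _ _ _ _ E)) addn0.
Qed.

(** * Binary words as lists of run lengths *)

Definition gap_word (k : seq nat) : seq nat :=
  nseq (head 0 k) 1 ++ flatten [seq 2 :: nseq x 1 | x <- behead k].

(** A word with d twos has d+1 runs of ones, some possibly empty; hence the
    empty word has one run. *)
Fixpoint gaps (w : seq nat) : seq nat :=
  if w is a :: w' then
    if a == 1 then (head 0 (gaps w')).+1 :: behead (gaps w') else 0 :: gaps w'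
  else [:: 0].

Lemma gaps_neq0 w : gaps w != [::].
Proof. by case: w => //= a w; case: ifP. Qed.

Lemma gap_word12 k : words12 (gap_word k).
Proof.
apply/words12_cat; split; first by rewrite /words12 /= all_nseq orbT.
elim: (behead k) => //= x s IH.
by apply/words12_cat; rewrite /words12 /= all_nseq orbT.
Qed.

Lemma gap_word_cons x k : k != [::] ->
  gap_word (x :: k) = nseq x 1 ++ 2 :: gap_word k.
Proof. by case: k. Qed.

Lemma gapsK w : words12 w -> gap_word (gaps w) = w.
Proof.
elim/words12_ind => // v _ IH; last first.
  by rewrite [gaps _]/= gap_word_cons ?gaps_neq0 //= IH.
rewrite [gaps _]/=.
case: (gaps v) (gaps_neq0 v) IH => // x k _.
by rewrite /gap_word /= => ->.
Qed.

Lemma gap_wordK k : k != [::] -> gaps (gap_word k) = k.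
Proof.
have ones m w : gaps (nseq m 1 ++ w) = (m + head 0 (gaps w)) :: behead (gaps w).
  elim: m => /= [|m ->] //.
  by case: (gaps w) (gaps_neq0 w).
elim: k => // x [|y k] IH _; first by rewrite /gap_word ones /= addn0.
by rewrite gap_word_cons // ones /= addn0 IH.
Qed.

Lemma count1_gaps w : words12 w -> sumn (gaps w) = count_mem 1 w.
Proof.
elim/words12_ind => // v _ /= <-.
by case: (gaps v) (gaps_neq0 v).
Qed.

Lemma count2_gaps w : words12 w -> size (gaps w) = (count_mem 2 w).+1.
Proof.
elim/words12_ind => // v _ /= IH; last by rewrite IH.
by case: (gaps v) (gaps_neq0 v) IH => // x k _ /= ->.
Qed.

(** * The ballot condition *)

(** The slack [c], the excess of ones over twos already read, makes the ballot
    condition amenable to induction on the word. *)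
Definition above (c : nat) (w : seq nat) : Prop :=
  forall i, count_mem 2 (take i w) <= c + count_mem 1 (take i w).

Lemma ballotP w : ballot w <-> words12 w /\ above 0 w.
Proof.
split=> -[w12 H]; split=> //; first by move=> i; apply/H/prefix_take.
by move=> u; rewrite prefixE => /eqP<-; apply: H.
Qed.

(** It is enough to test a ballot sequence just after each of its twos; just
    after the i-th one, the number of ones read is the sum of the first i run
    lengths. *)
Lemma above_gaps w c : words12 w ->
  above c w <-> forall i, i < size (gaps w) -> i <= c + sumn (take i (gaps w)).
Proof.
move=> w12; elim/words12_ind: w12 c => [c | v _ IH c | v _ IH c].
- by split=> // _ [].
- have -> : above c (1 :: v) <-> above c.+1 v.
    split=> [H i | H [|i]] //; first by have := H i.+1; rewrite /=; lia.
    by have := H i; rewrite /=; lia.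
  rewrite IH /=; case: (gaps v) (gaps_neq0 v) => // x k _ /=.
  by split=> H [|i] // lt_i; have := H i.+1 lt_i; rewrite /=; lia.
- have -> : above c (2 :: v) <-> 0 < c /\ above c.-1 v.
    split=> [H | [c_gt0 H] [|i]] //; last by have := H i; rewrite /=; lia.
    have c_gt0 : 0 < c by have := H 1; rewrite /= take0 /=; lia.
    by split=> // i; have := H i.+1; rewrite /=; lia.
  rewrite IH /=; split=> [[c_gt0 H] [|i] // lt_i | H].
    by have := H i lt_i; rewrite /=; lia.
  have c_gt0 : 0 < c.
    have H0 : 0 < size (gaps v) by case: (gaps v) (gaps_neq0 v).
    by have := H 1; rewrite /= take0 ltnS /= => /(_ H0); lia.
  by split=> // i lt_i; have := H i.+1 lt_i; rewrite /=; lia.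
Qed.

Definition ballot_gaps (n d : nat) : set (seq nat) :=
  [set k | [/\ size k = d.+1, sumn k + d = n &
               forall i, i <= d -> i <= sumn (take i k)]].

(** Writing the exponent condition additively avoids the integer subtraction. *)
Lemma BsetP n d w : Bset (n%:Z - d%:Z)%R d w <->
  [/\ words12 w, count_mem 1 w + d = n, count_mem 2 w = d & above 0 w].
Proof.
split=> [|[w12 c1 c2 w_above]].
  case E: (n%:Z - d%:Z)%R => [m|m] //= [w_perm /ballotP[w12 w_above]].
  split=> //; last by rewrite (permP w_perm) count_cat !count_nseq /=; lia.
  by rewrite (permP w_perm) count_cat !count_nseq /=; lia.
have -> : (n%:Z - d%:Z)%R = ((count_mem 1 w)%:Z)%R.
  by rewrite -c1 PoszD GRing.addrK.
split; last exact/ballotP.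
by have := perm_words12 w w12; rewrite c2.
Qed.

Lemma Bset_gap_word n d k : k != [::] ->
  Bset (n%:Z - d%:Z)%R d (gap_word k) <-> ballot_gaps n d k.
Proof.
move=> k0; have w12 := gap_word12 k.
have := above_gaps _ 0 w12.
have := count1_gaps _ w12; have := count2_gaps _ w12.
rewrite gap_wordK // BsetP => sk <- aboveE; split.
  move=> [_ kn kd /aboveE H]; rewrite kd in sk.
  by split=> // i le_i; apply: H; rewrite sk.
move=> [kd kn H]; move: sk; rewrite kd => -[sk].
by split=> //; apply/aboveE => i; rewrite kd; apply: H.
Qed.

Lemma gap_word_bij n d :
  set_bij (ballot_gaps n d) (Bset (n%:Z - d%:Z)%R d) gap_word.
Proof.
have k_neq0 k : ballot_gaps n d k -> k != [::] by case=> + _ _; case: k.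
split=> [k Kk | k k' /set_mem Kk /set_mem Kk' E | w Bw].
- exact/(Bset_gap_word _ _ _ (k_neq0 _ Kk)).
- by rewrite -(gap_wordK k) ?E ?gap_wordK //; apply: k_neq0.
- have [w12 _ _ _] := (BsetP _ _ _).1 Bw.
  exists (gaps w); last exact: gapsK.
  by apply/Bset_gap_word; [exact: gaps_neq0 | rewrite gapsK].
Qed.

(** * The bijections o and t *)

(** The run lengths of o(s): the word is read from the last entry of [s], and
    its final run is the only one that is not decremented. *)
Definition o_gaps (s : seq nat) : seq nat :=
  rcons [seq x.-1 | x <- rev (behead s)] (head 0 s).

(** The run lengths of t(s): here it is the initial run that is not
    decremented. *)
Definition t_gaps (s : seq nat) : seq nat :=
  last 0 s :: [seq x.-1 | x <- behead (rev s)].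

Lemma o_gaps_neq0 s : o_gaps s != [::].
Proof. by rewrite -size_eq0 size_rcons. Qed.

Lemma gap_word_rcons k m : gap_word (rcons k m) =
  flatten [seq rcons (nseq x 1) 2 | x <- k] ++ nseq m 1.
Proof.
elim: k => [|x k IH]; first by rewrite /gap_word /= cats0.
by rewrite rcons_cons gap_word_cons ?IH /= ?cat_rcons -?catA //; case: (k).
Qed.

Lemma o_mapE : o_map = gap_word \o o_gaps.
Proof. by apply/funext => s; rewrite /= gap_word_rcons -map_comp. Qed.

Lemma t_mapE : t_map = gap_word \o t_gaps.
Proof. by apply/funext => s; rewrite /t_map /gap_word /= -map_comp. Qed.

Lemma sum_nth_drop s N a : size s = N ->
  \sum_(a <= j < N) nth 0 s j = sumn (drop a s).
Proof.
move=> <-; rewrite -{1}[a]add0n big_addn sumnE [RHS](big_nth 0) size_drop.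
by apply: eq_bigr => i _; rewrite nth_drop addnC.
Qed.

Lemma sumn_pred q : all (fun x => 0 < x) q ->
  sumn [seq x.-1 | x <- q] + size q = sumn q.
Proof. by elim: q => //= x q IH /andP[x_gt0 /IH <-]; lia. Qed.

Lemma all_take (T : Type) (a : pred T) i (q : seq T) :
  all a q -> all a (take i q).
Proof. by rewrite -{1}[q](cat_take_drop i) all_cat => /andP[]. Qed.

Lemma sumn_drop_rev r i : all (fun x => 0 < x) r -> i <= size r ->
  sumn (drop (size r - i) r) = sumn (take i [seq x.-1 | x <- rev r]) + i.
Proof.
move=> r_pos le_i; rewrite -map_take.
have q_pos : all (fun x => 0 < x) (take i (rev r)).
  by rewrite all_take // all_rev.
have := sumn_pred _ q_pos; rewrite size_takel ?size_rev // => ->.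
by rewrite take_rev sumn_rev.
Qed.

(** Decrementing the last i entries lowers their sum by i and so turns the bound
    2i into i. *)
Lemma OsetP n d s : Oset n d s <->
  [/\ size s = d.+1, all (fun x => 0 < x) (behead s) &
      ballot_gaps n d (o_gaps s)].
Proof.
case: s => [|m r]; first by split=> [[]|[]].
have posE : size r = d ->
    all (fun x => 0 < x) r <->
    forall i, 0 < i <= d -> 0 < nth 0 (m :: r) i.
  move=> sr; split=> [/(all_nthP 0) H [|i] // lt_i | H].
    by apply: H; rewrite sr.
  by apply/(all_nthP 0) => i; rewrite sr; apply: (H i.+1).
have sumE i : size r = d -> all (fun x => 0 < x) r -> i <= d ->
    sumn (drop (d - i) r) = sumn (take i (o_gaps (m :: r))) + i.
  move=> sr r_pos le_i; rewrite /o_gaps /=.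
  rewrite -cats1 takel_cat ?size_map ?size_rev ?sr //.
  by rewrite -sumn_drop_rev ?sr.
have totE : size r = d -> all (fun x => 0 < x) r ->
    sumn (m :: r) = sumn (o_gaps (m :: r)) + d.
  move=> sr r_pos; have := sumE d sr r_pos (leqnn d).
  rewrite subnn drop0 /= => ->.
  rewrite /o_gaps /= -cats1 takel_cat ?size_map ?size_rev ?sr //.
  by rewrite take_oversize ?size_map ?size_rev ?sr // sumn_cat /=; lia.
have dropE i : size r = d -> 0 < i ->
    \sum_(d - i + 1 <= j < d.+1) nth 0 (m :: r) j = sumn (drop (d - i) r).
  by move=> sr i_gt0; rewrite sum_nth_drop /= ?sr // addn1.
split=> -[/= [sr]].
  move=> /(posE sr) r_pos sum_n H; split; rewrite /= ?sr //.
  rewrite sum_nth_drop ?drop0 ?totE //= ?sr // in sum_n.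
  split=> //; first by rewrite size_rcons size_map size_rev sr.
  case=> // i le_i; have := H i.+1 le_i.
  by rewrite dropE // sumE //; lia.
move=> r_pos [_ sum_n H]; split; rewrite /= ?sr //; first exact/posE.
  by rewrite sum_nth_drop ?drop0 ?totE //= sr.
move=> i /andP[i_gt0 le_i]; rewrite dropE // sumE //.
by have := H i le_i; lia.
Qed.

(** Of the last i entries only i - 1 are decremented, which turns the bound
    2i - 1 into i. *)
Lemma TsetP n d s : Tset n d s <->
  [/\ size s = d.+1, all (fun x => 0 < x) (behead (rev s)) &
      ballot_gaps n d (t_gaps s)].
Proof.
case/lastP: s => [|r m]; first by split=> [[]|[]].
rewrite rev_rcons [behead _]/= all_rev size_rcons.
have posE : size r = d ->
    all (fun x => 0 < x) r <-> forall i, i < d -> 0 < nth 0 (rcons r m) i.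
  move=> sr; split=> [/(all_nthP 0) H i lt_i | H].
    by rewrite nth_rcons sr lt_i H ?sr.
  by apply/(all_nthP 0) => i; rewrite sr => lt_i;
    have := H i lt_i; rewrite nth_rcons sr lt_i.
have gapsE : t_gaps (rcons r m) = m :: [seq x.-1 | x <- rev r].
  by rewrite /t_gaps last_rcons rev_rcons.
have sumE i : size r = d -> all (fun x => 0 < x) r -> i <= d ->
    sumn (drop (d - i) (rcons r m)) = sumn (take i.+1 (t_gaps (rcons r m))) + i.
  move=> sr r_pos le_i; rewrite gapsE /= drop_rcons ?sr ?leq_subr //.
  rewrite -cats1 sumn_cat -[in d - i]sr sumn_drop_rev ?sr //=; lia.
have totE : size r = d -> all (fun x => 0 < x) r ->
    sumn (rcons r m) = sumn (t_gaps (rcons r m)) + d.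
  move=> sr r_pos; have := sumE d sr r_pos (leqnn d).
  by rewrite subnn drop0 take_oversize // gapsE /= size_map size_rev sr.
have dropE i : size r = d -> i < d ->
    \sum_(d - i.+1 + 1 <= j < d.+1) nth 0 (rcons r m) j =
    sumn (drop (d - i) (rcons r m)).
  move=> sr lt_i; rewrite sum_nth_drop ?size_rcons ?sr //.
  by congr (sumn (drop _ _)); lia.
split=> -[/=]; rewrite ?size_rcons => -[sr].
  move=> /(posE sr) r_pos sum_n H; split; rewrite /= ?sr //.
  rewrite sum_nth_drop ?size_rcons ?sr // drop0 totE // in sum_n.
  split=> //; first by rewrite gapsE /= size_map size_rev sr.
  case=> // i le_i; have := H i.+1 le_i.
  by rewrite dropE // sumE ?(ltnW le_i) //; lia.
move=> r_pos [_ sum_n H]; split; rewrite /= ?size_rcons ?sr //.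
- exact/posE.
- by rewrite sum_nth_drop ?size_rcons ?sr // drop0 totE.
- case=> // i le_i; rewrite dropE // sumE ?(ltnW le_i) //.
  by have := H i.+1 le_i; lia.
Qed.

Lemma pos_predK q : all (fun x => 0 < x) q ->
  [seq x.+1 | x <- [seq x.-1 | x <- q]] = q.
Proof. by elim: q => //= x q IH /andP[/prednK-> /IH->]. Qed.

Lemma succK q : [seq x.-1 | x <- [seq x.+1 | x <- q]] = q.
Proof. by rewrite -map_comp map_id_in. Qed.

Lemma o_gaps_bij n d : set_bij (Oset n d) (ballot_gaps n d) o_gaps.
Proof.
split=> [s /OsetP[] // |
  s s' /set_mem/OsetP[ss sp _] /set_mem/OsetP[ss' sp' _] | k Kk].
  case: s s' ss ss' sp sp' => [|m r] [|m' r'] //= _ _ r_pos r_pos'.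
  move/rcons_inj => -[E ->]; congr cons.
  by rewrite -[r]revK -[r']revK -[rev r]pos_predK ?E ?pos_predK ?all_rev.
case/lastP: k Kk => [[]|k m] // Kk.
have E : o_gaps (m :: rev [seq x.+1 | x <- k]) = rcons k m.
  by rewrite /o_gaps /= revK succK.
exists (m :: rev [seq x.+1 | x <- k]) => //.
apply/OsetP; rewrite E; split=> //=.
  by case: Kk; rewrite size_rcons size_rev size_map.
by rewrite all_rev all_map; apply/allP.
Qed.

Lemma t_gaps_bij n d : set_bij (Tset n d) (ballot_gaps n d) t_gaps.
Proof.
split=> [s /TsetP[] // |
  s s' /set_mem/TsetP[ss sp _] /set_mem/TsetP[ss' sp' _] | k Kk].
  case/lastP: s ss sp => // r m _; case/lastP: s' ss' sp' => // r' m' _.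
  rewrite /t_gaps !rev_rcons !last_rcons /= => r_pos' r_pos [-> E].
  by congr rcons; rewrite -[r]revK -[r']revK -[rev r]pos_predK ?E ?pos_predK.
case: k Kk => [[]|m k] // Kk.
have E : t_gaps (rev (m :: [seq x.+1 | x <- k])) = m :: k.
  by rewrite /t_gaps revK rev_cons last_rcons /= succK.
exists (rev (m :: [seq x.+1 | x <- k])) => //.
apply/TsetP; rewrite E revK; split=> //=; last by rewrite all_map; apply/allP.
by case: Kk; rewrite size_rev /= size_map.
Qed.

Lemma o_map_bij n d : set_bij (Oset n d) (Bset (n%:Z - d%:Z)%R d) o_map.
Proof.
by rewrite o_mapE; apply: set_bij_comp (o_gaps_bij n d) (gap_word_bij n d).
Qed.

Lemma t_map_bij n d : set_bij (Tset n d) (Bset (n%:Z - d%:Z)%R d) t_map.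
Proof.
by rewrite t_mapE; apply: set_bij_comp (t_gaps_bij n d) (gap_word_bij n d).
Qed.

(** * Cutting a balanced ballot sequence *)

Lemma BdiagP n w : Bdiag n w <->
  [/\ words12 w, count_mem 1 w = n, count_mem 2 w = n & above 0 w].
Proof.
have rearr : perm_eq w (nseq n 1 ++ nseq n 2) ->
    count_mem 1 w = n /\ count_mem 2 w = n.
  by move=> w_perm; rewrite !(permP w_perm) !count_cat !count_nseq /=; lia.
split=> [[/rearr[c1 c2] /ballotP[w12 w_above]] // | [w12 c1 c2 w_above]].
split; last exact/ballotP.
by have := perm_words12 w w12; rewrite c1 c2.
Qed.

(** As the whole word is balanced, the excess of ones over twos in a prefix that
    leaves out the last i letters equals the excess of twos over ones in those
    letters, which is the excess of ones over twos in the first i letters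
    of [y]. *)
Lemma above_cat_prime x y : words12 y ->
  count_mem 1 x + count_mem 2 y = count_mem 2 x + count_mem 1 y ->
  above 0 (x ++ prime_word y) <-> above 0 x /\ above 0 y.
Proof.
move=> y12 bal.
have cutE i : i <= size y ->
    (count_mem 2 (x ++ take (size y - i) (prime_word y)) <=
       count_mem 1 (x ++ take (size y - i) (prime_word y))) =
    (count_mem 2 (take i y) <= count_mem 1 (take i y)).
  move=> le_i.
  have take12 : words12 (take i y) by apply: all_take.
  have dropE : drop (size y - i) (prime_word y) = prime_word (take i y).
    rewrite -[in LHS](cat_take_drop i y) prime_cat drop_size_cat //.
    by rewrite size_prime cat_take_drop size_drop.
  have := count1_prime _ y12; have := count2_prime _ y12.
  rewrite -[prime_word y in X in X -> _](cat_take_drop (size y - i)).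
  rewrite -[prime_word y in X in _ -> X -> _](cat_take_drop (size y - i)).
  rewrite !dropE !count_cat count1_prime // count2_prime //; lia.
split=> [H | [Hx Hy] i].
  split=> i.
    case: (leqP i (size x)) => [le_i | /ltnW le_i].
      by have := H i; rewrite takel_cat.
    by rewrite take_oversize //; have := H (size x); rewrite take_size_cat.
  have Hy j : j <= size y -> count_mem 2 (take j y) <= count_mem 1 (take j y).
    move=> le_j; rewrite -cutE //; have := H (size x + (size y - j)).
    by rewrite take_cat ltnNge leq_addr addKn.
  case: (leqP i (size y)) => [/Hy // | /ltnW le_i].
  by rewrite take_oversize //; have := Hy _ (leqnn _); rewrite take_size.
rewrite take_cat; case: ltnP => [_ | le_i]; first exact: Hx.
set j := i - size x; rewrite add0n.
case: (leqP j (size y)) => [le_j | /ltnW le_j].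
  by rewrite -[j](subKn le_j) cutE ?leq_subr //; apply: Hy.
rewrite take_oversize ?size_prime //; have := cutE 0 isT.
by rewrite subn0 take_oversize ?size_prime // => ->; rewrite take0.
Qed.

(** Two words of length n whose concatenation x y' is balanced have equally many
    twos, so d serves for both. *)
Lemma Bdiag_cat n d x y : words12 y -> size x = n -> count_mem 2 x = d ->
  Bdiag n (x ++ prime_word y) <->
  Bset (n%:Z - d%:Z)%R d x /\ Bset (n%:Z - d%:Z)%R d y.
Proof.
move=> y12 sx c2x; rewrite BdiagP !BsetP !count_cat.
rewrite (count1_prime _ y12) (count2_prime _ y12).
split=> [[/words12_cat[x12 _] c1 c2 w_above] | [[x12 c1 _ ax] [_ c1' c2' ay]]].
  have := size_words12 _ x12; rewrite sx c2x => nE.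
  have /(above_cat_prime x _ y12)[H _] :
      count_mem 1 x + count_mem 2 y = count_mem 2 x + count_mem 1 y by lia.
  by have [? ?] := H w_above; split; split=> //; lia.
split; try lia.
  by apply/words12_cat; split=> //; apply: prime_word12.
by apply/above_cat_prime => //; lia.
Qed.

Lemma beta_Bdiag n w : Bdiag n w ->
  let e := count_mem 2 (take n w) in
  [/\ Bset (n%:Z - e%:Z)%R e (take n w),
      Bset (n%:Z - e%:Z)%R e (prime_word (drop n w)) &
      w = take n w ++ prime_word (prime_word (drop n w))].
Proof.
move=> Bw e; have [w12 c1 c2 _] := (BdiagP _ _).1 Bw.
have [x12 y12] : words12 (take n w) /\ words12 (drop n w).
  by apply/words12_cat; rewrite cat_take_drop.
have sw := size_words12 _ w12; rewrite c1 c2 in sw.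
have wE : w = take n w ++ prime_word (prime_word (drop n w)).
  by rewrite prime_wordK // cat_take_drop.
have sx : size (take n w) = n by rewrite size_takel // sw leq_addr.
have := Bdiag_cat n e _ _ (prime_word12 _ y12) sx erefl.
by rewrite -wE => -[/(_ Bw)[]].
Qed.

(** * The bijection omega x tau and the inverse of phi *)

Lemma omega_pos v : words12 v ->
  [/\ size (omega v) = (des v).+1, size (tau v) = (des v).+1,
      all (fun x => 0 < x) (behead (omega v)) &
      all (fun x => 0 < x) (behead (rev (tau v)))].
Proof.
move=> v12; have [_ sb om_pos tau_pos] := blocksP v12.
have so : size (omega v) = (des v).+1 by rewrite /omega size_map.
have st : size (tau v) = (des v).+1 by rewrite /tau size_map.
split=> //.
  apply/(all_nthP 0) => i; rewrite size_behead so nth_behead => lt_i.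
  exact: om_pos.
case/lastP: (tau v) st tau_pos => // t m; rewrite size_rcons => -[st] tau_pos.
rewrite rev_rcons /= all_rev; apply/(all_nthP 0) => i; rewrite st => lt_i.
by have := tau_pos _ lt_i; rewrite nth_rcons st lt_i.
Qed.

Lemma omega_tau_inj v v' : words12 v -> words12 v' ->
  omega_tau v = omega_tau v' -> v = v'.
Proof.
move=> v12 v12' [omE tauE].
have [-> _ _ _] := blocksP v12; have [-> _ _ _] := blocksP v12'.
rewrite -[blocks v]zip_unzip -[blocks v']zip_unzip.
by rewrite -/(omega v) -/(tau v) omE tauE.
Qed.

Lemma Bset_o_map n d s : size s = d.+1 ->
  all (fun x => 0 < x) (behead s) ->
  Bset (n%:Z - d%:Z)%R d (o_map s) <-> Oset n d s.
Proof.
move=> ss s_pos; rewrite OsetP o_mapE /= Bset_gap_word; last exact: o_gaps_neq0.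
by split=> // -[].
Qed.

Lemma Bset_t_map n d s : size s = d.+1 ->
  all (fun x => 0 < x) (behead (rev s)) ->
  Bset (n%:Z - d%:Z)%R d (t_map s) <-> Tset n d s.
Proof.
move=> ss s_pos; rewrite TsetP t_mapE /= Bset_gap_word //.
by split=> // -[].
Qed.

Lemma count2_o_map s : count_mem 2 (o_map s) = (size s).-1.
Proof.
rewrite o_mapE /=.
have := count2_gaps _ (gap_word12 (o_gaps s)).
rewrite gap_wordK ?o_gaps_neq0 //.
by rewrite size_rcons size_map size_rev size_behead => -[].
Qed.

Lemma t_map12 s : words12 (t_map s).
Proof. by rewrite t_mapE; apply: gap_word12. Qed.

(** The formula for phi v and the cut at its middle turn membership in A_{n,d}
    into a condition on o (omega v) and one on t (tau v).  The size hypothesis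
    is what puts the cut in the middle; it is available both when phi v is known
    to be in B_n and when omega v is known to be in O_{n,d}. *)
Lemma Aset_phi n v : words12 v -> size (o_map (omega v)) = n ->
  Aset n (des v) v <-> Oset n (des v) (omega v) /\ Tset n (des v) (tau v).
Proof.
move=> v12 so; have [s_om s_tau om_pos tau_pos] := omega_pos _ v12.
rewrite -Bset_o_map // -Bset_t_map //.
have c2 : count_mem 2 (o_map (omega v)) = des v by rewrite count2_o_map s_om.
rewrite -Bdiag_cat -?phiE //; last exact: t_map12.
by split=> [[] | ].
Qed.

Lemma omega_tau_fun n d v :
  Aset n d v -> Oset n d (omega v) /\ Tset n d (tau v).
Proof.
move=> Av; have [v12 dv Bv] := Av; rewrite -dv in Av *.
apply/Aset_phi => //; rewrite size_o_map_omega //.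
have [_ <- _ _] := (BdiagP _ _).1 Bv.
by rewrite (permP (perm_phi v)).
Qed.

Lemma omega_tau_surj n d om ta : Oset n d om -> Tset n d ta ->
  exists v, [/\ Aset n d v, omega v = om & tau v = ta].
Proof.
move=> Oom Tta.
have [s_om om_pos _] := (OsetP _ _ _).1 Oom.
have [s_ta ta_pos _] := (TsetP _ _ _).1 Tta.
pose v := unblocks (zip om ta).
have v12 : words12 v by apply: unblocks12.
have z1 : unzip1 (zip om ta) = om by rewrite unzip1_zip // s_om s_ta.
have z2 : unzip2 (zip om ta) = ta by rewrite unzip2_zip // s_om s_ta.
have blocksE : blocks v = zip om ta.
  by apply: unblocksK; rewrite ?z1 ?z2 // -size_eq0 size_zip s_om s_ta minnn.
have omE : omega v = om by rewrite /omega blocksE.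
have taE : tau v = ta by rewrite /tau blocksE.
have dv : des v = d.
  by have [s_v _ _ _] := omega_pos _ v12; move: s_v; rewrite omE s_om => -[].
exists v; split=> //; rewrite -[in Aset n d]dv; apply/Aset_phi => //.
  have [o12 c1 c2 _] := (BsetP _ _ _).1 ((Bset_o_map _ _ _ s_om om_pos).2 Oom).
  by rewrite omE size_words12 // c2 c1.
by rewrite omE taE dv.
Qed.

Lemma omega_tau_bij n d :
  set_bij (Aset n d) (Oset n d `*` Tset n d) omega_tau.
Proof.
split=> [v /omega_tau_fun[] // | v v' /set_mem[v12 _ _] /set_mem[v12' _ _] |].
  exact: omega_tau_inj.
move=> [om ta] [/= Oom Tta].
by have [v [Av omE taE]] := omega_tau_surj _ _ _ _ Oom Tta;
  exists v => //; rewrite /omega_tau omE taE.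
Qed.

(** Split w into x y', write x and y as values of o and t, and take the word
    with the corresponding exponents. *)
Lemma phi_onto_Bdiag n w : Bdiag n w -> exists2 v, words12 v & phi v = w.
Proof.
move=> /beta_Bdiag /=; set e := count_mem 2 _ => -[Bx By ->].
have [_ _ o_surj] := o_map_bij n e; have [_ _ t_surj] := t_map_bij n e.
have [om Oom <-] := o_surj _ Bx; have [ta Tta <-] := t_surj _ By.
have [v [[v12 _ _] omE taE]] := omega_tau_surj _ _ _ _ Oom Tta.
by exists v => //; rewrite phiE // omE taE.
Qed.

(** [phi_inv] picks some preimage among all words over the positive integers; it
    is binary because phi only rearranges letters. *)
Lemma phi_invP n w : Bdiag n w -> words12 (phi_inv w) /\ phi (phi_inv w) = w.
Proof.
move=> Bw; have [v v12 vE] := phi_onto_Bdiag _ _ Bw.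
have w_im : w \in phi @` words.
  apply/mem_set; exists v => //; apply: sub_all v12 => a.
  by rewrite !inE => /orP[] /eqP->.
have phiK : phi (phi_inv w) = w by apply: pinvK.
split=> //; have [w12 _ _ _] := (BdiagP _ _).1 Bw.
by rewrite /words12 /= -(perm_all _ (perm_phi _)) phiK.
Qed.

Lemma betaE n v : words12 v -> Bdiag n (phi v) ->
  beta n (phi v) = o_t (omega_tau v).
Proof.
move=> v12 Bv; have [_ c1 _ _] := (BdiagP _ _).1 Bv.
have so : size (o_map (omega v)) = n.
  by rewrite size_o_map_omega // -c1 (permP (perm_phi v)).
rewrite /beta phiE // take_size_cat // drop_size_cat //.
by rewrite prime_wordK //; apply: t_map12.
Qed.

(** * Cardinalities *)

Lemma set_bij_card (T U : Type) (A : set T) (B : set U) (f : T -> U) :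
  set_bij A B f -> A #= B.
Proof.
move=> [f_fun f_inj f_surj]; have := inj_card_eq f_inj.
rewrite (surj_image_eq _ f_surj) 1?card_eq_sym //.
by move=> _ [x Ax <-]; apply: f_fun.
Qed.

Lemma card_setX_finite (T U : choiceType) (A : set T) (B : set U) m n :
  A #= `I_m -> B #= `I_n -> A `*` B #= `I_(m * n).
Proof.
move=> Am Bn.
have Afin : finite_set A by apply/finite_setP; exists m.
have Bfin : finite_set B by apply/finite_setP; exists n.
have [N ABN] := (finite_setP _).1 (finite_setX Afin Bfin).
suff <- : N = m * n by [].
rewrite -(card_fset_set ABN) -(card_fset_set Am) -(card_fset_set Bn).
rewrite fset_setX // -(size_allpairs pair); apply/perm_size/uniq_perm.
- exact: fset_uniq.
- by apply: allpairs_uniq; rewrite ?fset_uniq // => -[? ?] [? ?].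
- move=> [x y]; rewrite in_fsetM /=.
  apply/andP/allpairsP => [[xA yB] | [[? ?] /= [? ? [-> ->]]] //].
  by exists (x, y).
Qed.

Lemma card_Bset n d : Bset (n%:Z - d%:Z)%R d #= `I_(Cnum n d).
Proof.
have /finite_setP[N BN] : finite_set (Bset (n%:Z - d%:Z)%R d).
  apply: (@sub_finite_set _ _ [set` permutations (nseq (n - d) 1 ++ nseq d 2)]).
    move=> w /BsetP[w12 c1 c2 _]; rewrite /= mem_permutations.
    by have := perm_words12 w w12; rewrite c2 -c1 addnK.
  exact: finite_seq.
by rewrite /Cnum (card_fset_set BN).
Qed.

Theorem theorem3p4 (n d : nat) :
  [/\ set_bij (Oset n d) (Bset (n%:Z - d%:Z)%R d) o_map,
      set_bij (Tset n d) (Bset (n%:Z - d%:Z)%R d) t_map,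
      Oset n d #= `I_(Cnum n d) & Tset n d #= `I_(Cnum n d)]
  /\
  (set_bij (Aset n d) (Oset n d `*` Tset n d) omega_tau /\ Aset n d #= `I_(Cnum n d ^ 2))
  /\
  [/\ set_fun (Bdiag n)
        (\bigcup_(e in [set: nat])
           (Bset (n%:Z - e%:Z)%R e `*` Bset (n%:Z - e%:Z)%R e)) (beta n),
      set_fun (Bdiag n) (\bigcup_(e in [set: nat]) Aset n e) phi_inv &
      {in Bdiag n, beta n =1 o_t \o omega_tau \o phi_inv}].
Proof.
have O_card : Oset n d #= `I_(Cnum n d).
  exact: card_eq_trans (set_bij_card _ _ _ _ _ (o_map_bij n d)) (card_Bset n d).
have T_card : Tset n d #= `I_(Cnum n d).
  exact: card_eq_trans (set_bij_card _ _ _ _ _ (t_map_bij n d)) (card_Bset n d).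
split; first by split=> //; [exact: o_map_bij | exact: t_map_bij].
split.
  split; first exact: omega_tau_bij.
  apply: card_eq_trans (set_bij_card _ _ _ _ _ (omega_tau_bij n d)) _.
  exact: card_setX_finite.
split=> [w Bw | w Bw | w /set_mem Bw].
- by have [Bx By _] := beta_Bdiag _ _ Bw; exists (count_mem 2 (take n w)).
- have [v12 phiK] := phi_invP _ _ Bw.
  by exists (des (phi_inv w)) => //; split=> //; rewrite phiK.
- have [v12 phiK] := phi_invP _ _ Bw.
  by rewrite /= -(betaE n) ?phiK.
Qed.
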